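(* Let $1\le c\le a\le b$ be integers and let $F_{a,b,c}$ be the graph obtained from vertex-disjoint cliques $K_a$ and $K_b$ by adding $c$ pairwise vertex-disjoint edges, each joining a vertex of $K_a$ to a vertex of $K_b$. Let $v=a+b$ and $\ell=\binom a2+\binom b2+c$ be its numbers of vertices and edges, and let $g^*_1$, $g^*_2$ be defined with respect to $F=F_{a,b,c}$. (1) If $a<b$, then, for every integer $n\ge v$, $\mathrm{wsat}(n,F_{a,b,c})=g^*_1(n-v)+\ell-1$. (2) If $a=b=5$ and $c=4$, then, for every integer $n\ge v$, $\mathrm{wsat}(n,F_{a,b,c})=g^*_2(n-v)+\ell-1$.
   Context: All graphs are finite and simple. Given a graph $F$, an $F$-bootstrap percolation process is a sequence of graphs $H_0\subset H_1\subset\cdots\subset H_m$ on the same vertex set such that, for each $i=1,\ldots,m$, $H_i$ is obtained from $H_{i-1}$ by adding one edge that belongs to a copy of $F$ (a not necessarily induced subgraph isomorphic to $F$) in $H_i$. A graph $H$ on $[n]=\{1,\ldots,n\}$ is weakly $F$-saturated if there is an $F$-bootstrap percolation process $H=H_0\subset\cdots\subset H_m=K_n$. The number $\mathrm{wsat}(n,F)$ is the minimum number of edges of a weakly $F$-saturated graph on $[n]$. For a graph $F$ with $v$ vertices and $i\in[v]$, let $e_i=\min_{S\subset V(F),\,|S|=i}|E(F)\setminus E(F\setminus S)|-1$, where $F\setminus S$ is the subgraph of $F$ induced on $V(F)\setminus S$. For $r\in\{1,2\}$ with $r\le v-1$ define $g^*_r(0)=0$ and, for $i\ge1$, $g^*_r(i)=\min(e_{i_1}+\cdots+e_{i_s})$,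 the minimum being over all $s\in[i]$ and all integers $1\le i_1,\ldots,i_s\le v-r$ with $i_1+\cdots+i_s=i$. (The paper writes $g^*$ for $g^*_1$.) *)

(* Defs.v *)
From HB Require Import structures.
From mathcomp Require Import all_boot all_order all_algebra.

Set Implicit Arguments.
Unset Strict Implicit.
Unset Printing Implicit Defensive.

Import Order.TTheory GRing.Theory Num.Theory.

Record sgraph (T : finType) := SGraph {
  edges : {set {set T}};
  edges_pairs : edges \subset [set e : {set T} | #|e| == 2]
}.

HB.instance Definition _ (T : finType) := [isSub for @edges T].
HB.instance Definition _ (T : finType) := [Countable of sgraph T by <:].
HB.instance Definition _ (T : finType) := [Finite of sgraph T by <:].

Section Graphs.
Variable T : finType.

Definition rel_edges (r : rel T) : {set {set T}} :=
  [set [set p.1; p.2] | p in [pred p : T * T | (p.1 != p.2) && r p.1 p.2]].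

Lemma rel_edges_pairs (r : rel T) :
  rel_edges r \subset [set e : {set T} | #|e| == 2].
Proof.
by apply/subsetP => _ /imsetP[p /andP[np _] ->]; rewrite inE cards2 np.
Qed.

Definition graph_of_rel (r : rel T) : sgraph T := SGraph (rel_edges_pairs r).

Definition complete : sgraph T := graph_of_rel (fun _ _ => true).

End Graphs.

Arguments complete : clear implicits.

Section Saturation.
Variables (U : finType) (F : sgraph U).

(* A copy of F in H is the image of F under an injective map of the vertices
   that sends edges to edges. *)
Definition in_copy (T : finType) (H : sgraph T) (e : {set T}) : bool :=
  [exists f : {ffun U -> T},
    let copy := [set f @: d | d : {set U} in edges F] in
    [&& injectiveb f, copy \subset edges H & e \in copy]].

Definition bootstrap_step (T : finType) : rel (sgraph T) := fun H H' =>
  [exists e : {set T},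
    [&& e \notin edges H, edges H' == e |: edges H & in_copy H' e]].

Definition weakly_saturated (T : finType) (H : sgraph T) : bool :=
  connect (@bootstrap_step T) H (complete T).

(* The complete graph is weakly saturated (by the process of length 0), so the
   minimum is over a nonempty set. *)
Definition wsat (n : nat) : nat :=
  #|edges [arg min_(H < complete 'I_n | weakly_saturated H) #|edges H|]|.

Definition del_edges (S : {set U}) : {set {set U}} :=
  [set d in edges F | d \subset ~: S].

(* The neutral element #|edges F| bounds every term from above, so it does not
   affect the minimum when 1 <= i <= #|U|.  The value is an integer because it
   is -1 if F has i isolated vertices. *)
Definition e_ (i : nat) : int :=
  ((\big[minn/#|edges F|]_(S : {set U} | #|S| == i)
      #|edges F :\: del_edges S|)%:Z - 1)%R.

(* The neutral element e_ 1 *+ i is the term given by s = i and all parts equal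
   to 1, which is admissible for i >= 1 and r <= #|U| - 1; for i = 0 the range
   of s is empty and the value is 0. *)
Definition gstar (r i : nat) : int :=
  let d := (e_ 1 *+ i)%R in
  \big[Order.min/d]_(1 <= s < i.+1)
    \big[Order.min/d]_(t : s.-tuple 'I_(#|U| - r).+1 |
        [forall k, 0 < tnth t k] && (\sum_(k < s) tnth t k == i))
      (\sum_(k < s) e_ (tnth t k))%R.

End Saturation.

(* The cliques have vertex sets 'I_a and 'I_b; the c additional disjoint edges
   join the vertices with the same index i < c.  For c <= a <= b any other
   choice of c disjoint edges gives an isomorphic graph. *)
Definition dumbbell_rel (a b c : nat) : rel ('I_a + 'I_b) := fun x y =>
  match x, y with
  | inl _, inl _ => true
  | inr _, inr _ => true
  | inl i, inr j => (i == j :> nat) && (i < c)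
  | inr _, inl _ => false
  end.

Definition dumbbell (a b c : nat) : sgraph ('I_a + 'I_b)%type :=
  graph_of_rel (@dumbbell_rel a b c).

(* Main.v *)
(* Lower bound, for any F with v >= 3 vertices, l edges and no isolated vertex,
   and r <= 2: put h(m) = g*_r(m - v) + l - 1 and cover the current graph by
   vertex sets Y of size at least v, each of cost h(|Y|), and by single edges
   of cost 1. When a copy of F is completed by an uncovered edge, merge V(F)
   with all sets Y meeting it in at least two vertices. If S is the trace of Y
   on V(F), then the vertices new to Y number v - |S|, and
   e_{v - |S|} <= l - e(S) - 1; adding this over the sets Y shows that the cost
   does not increase. On K_n the cost can be decreased until the whole vertex
   set is one of the covering sets, hence it is at least h(n).

   Upper bound: if a clique Q and a disjoint clique R contain the two sides of
   a copy of F, and R has a vertex to spare, then moving the links one at a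
   time yields all edges between Q and R. Hence l - 1 edges span K_v, and a
   clique K_m extends to K_{m+j}, for j <= a, at the cost e_j of attaching j
   vertices of the K_a side. For j = a + t the set realising e_j consists of
   the K_a side and t vertices of the K_b side; comparing binomials, it costs
   at least as much as attaching the a + t vertices in groups of size at most
   a, so larger groups are never needed. *)
Require Import Defs.
From HB Require Import structures.
From mathcomp Require Import all_boot all_order all_algebra.
From mathcomp Require Import perm zify.

Set Implicit Arguments.
Unset Strict Implicit.
Unset Printing Implicit Defensive.

Import Order.TTheory GRing.Theory Num.Theory.

(** * The optimum g* as a minimum over lists of parts *)

Section PartsOptimum.
Variables (U : finType) (F : sgraph U).

Definition edges_meeting (S : {set U}) : nat := #|edges F :\: del_edges F S|.

(** Lists of parts replace the lengths and tuples of [gstar]: concatenating two lists then yields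
    subadditivity. *)
Definition admissible (r : nat) (w : seq nat) : bool :=
  all (fun x => 0 < x <= #|U| - r) w.

Lemma del_edges_sub (S : {set U}) : del_edges F S \subset edges F.
Proof. by apply/subsetP => d; rewrite inE => /andP[]. Qed.

Lemma edges_meeting_del (S : {set U}) :
  edges_meeting S + #|del_edges F S| = #|edges F|.
Proof.
rewrite /edges_meeting cardsD addnC (setIidPr (del_edges_sub S)).
by rewrite subnKC // subset_leq_card // del_edges_sub.
Qed.

Lemma e_le (S : {set U}) : (e_ F #|S| <= (edges_meeting S)%:Z - 1)%R.
Proof.
rewrite /e_ lerD2r lez_nat -minEnat.
exact: (@bigmin_le_cond _ nat _ _ S (fun S' : {set U} => #|S'| == #|S|)
  edges_meeting (eqxx _)).
Qed.

(** The first hypothesis takes care of the neutral element of the iterated minimum, the second of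
    its terms. *)
Lemma e_ge (i m : nat) :
    m <= #|edges F| ->
    (forall S : {set U}, #|S| = i -> m <= edges_meeting S) ->
  (m%:Z - 1 <= e_ F i)%R.
Proof.
move=> mF mS; rewrite /e_ lerD2r lez_nat.
elim/big_ind: _ => // [x y mx my|S /eqP/mS//]; by rewrite leq_min mx my.
Qed.

Lemma gstar_le (r : nat) (w : seq nat) :
  admissible r w -> (gstar F r (sumn w) <= \sum_(x <- w) e_ F x)%R.
Proof.
move=> adw; have [->|w0] := eqVneq w [::].
  by rewrite big_nil /gstar big_geq.
(* Parts are positive, so their number lies in the range of the outer minimum. *)
have szw : 0 < size w <= sumn w.
  rewrite lt0n size_eq0 w0 /=; move: adw; rewrite /admissible; clear.
  by elim: w => //= x w IH /andP[/andP[x0 _] /IH]; lia.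
rewrite /gstar; apply: (@bigmin_inf_seq _ _ _ _ _ (size w)) => //.
  by rewrite mem_index_iota ltnS.
have ltw (k : 'I_(size w)) : nth 0 w k < (#|U| - r).+1.
  by have /andP[_ ?] := all_nthP 0 adw k (ltn_ord k).
pose t := [tuple Ordinal (ltw k) | k < size w].
have tE k : tnth t k = nth 0 w k :> nat by rewrite tnth_mktuple.
apply: (@bigmin_inf _ _ _ _ t).
  apply/andP; split.
    apply/forallP => k; rewrite tE.
    by have /andP[] := all_nthP 0 adw k (ltn_ord k).
  apply/eqP; rewrite (eq_bigr (fun k : 'I__ => nth 0 w k)) => [|k _]; last exact: tE.
  by rewrite sumnE (big_nth 0) big_mkord.
rewrite [leRHS](big_nth 0) big_mkord; rewrite le_eqVlt; apply/orP; left.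
by apply/eqP/eq_bigr => k _; rewrite tE.
Qed.

(** Being the cost of an admissible list of sum [i] is preserved by minima, and the neutral element
    is such a cost through [i] parts equal to 1. *)
Lemma gstar_attained (r i : nat) :
    r < #|U| ->
  exists w, [/\ admissible r w, sumn w = i & gstar F r i = \sum_(x <- w) e_ F x]%R.
Proof.
move=> rU; pose K z := exists w, [/\ admissible r w, sumn w = i &
  z = \sum_(x <- w) e_ F x]%R.
have Kmin x y : K x -> K y -> K (Order.min x y).
  by move=> Kx Ky; rewrite minElt; case: ifP.
have Kd : K (e_ F 1 *+ i)%R.
  exists (nseq i 1); split.
  - by rewrite /admissible all_nseq /= subn_gt0 rU orbT.
  - by rewrite sumn_nseq mul1n.
  - by rewrite big_nseq iter_addr_0.
rewrite /gstar; elim/big_ind: _ => // s _.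
elim/big_ind: _ => // t /andP[/forallP t0 /eqP ti].
exists [seq nat_of_ord x | x <- t]; split.
- apply/allP => _ /mapP[x /tnthP[k ->] ->]; rewrite (t0 k) /=.
  by have := ltn_ord (tnth t k).
- by rewrite sumnE big_map big_tuple.
- by rewrite big_map big_tuple.
Qed.

Lemma admissible_cat (r : nat) (w1 w2 : seq nat) :
  admissible r (w1 ++ w2) = admissible r w1 && admissible r w2.
Proof. exact: all_cat. Qed.

Lemma gstar0 (r : nat) : gstar F r 0 = 0%R.
Proof. by rewrite /gstar big_geq. Qed.

Lemma gstar_subadditive (r i j : nat) :
  r < #|U| -> (gstar F r (i + j) <= gstar F r i + gstar F r j)%R.
Proof.
move=> rU; have [w1 [ad1 <- ->]] := gstar_attained i rU.
have [w2 [ad2 <- ->]] := gstar_attained j rU.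
by rewrite -sumn_cat -big_cat gstar_le // admissible_cat ad1.
Qed.

Lemma gstar_le_e (r i : nat) :
  0 < i <= #|U| - r -> (gstar F r i <= e_ F i)%R.
Proof.
move=> iU; have := @gstar_le r [:: i]; rewrite /admissible /= andbT addn0 big_seq1.
exact.
Qed.

Hypothesis no_isolated : forall u, exists2 d, d \in edges F & u \in d.

Lemma e_ge0 (i : nat) : 0 < #|U| -> 0 < i -> (0 <= e_ F i)%R.
Proof.
move=> /card_gt0P[u _] i0; have := @e_ge i 1; rewrite subrr; apply.
  by have [d dF _] := no_isolated u; apply/card_gt0P; exists d.
move=> S Si; have /card_gt0P[x xS] : 0 < #|S| by rewrite Si.
have [d dF xd] := no_isolated x; apply/card_gt0P; exists d.
rewrite !inE dF andbT; apply/negP => /andP[_ /subsetP/(_ x xd)].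
by rewrite inE xS.
Qed.

Lemma gstar_ge0 (r i : nat) : r < #|U| -> (0 <= gstar F r i)%R.
Proof.
move=> rU; have [w [adw _ ->]] := gstar_attained i rU.
rewrite big_seq; apply: sumr_ge0 => x /(allP adw)/andP[x0 _].
by apply: e_ge0 => //; apply: leq_ltn_trans rU.
Qed.

(** Deleting a vertex from a set of size [i.+1] cannot increase the number of edges it meets. *)
Lemma e_mono (i : nat) : i < #|U| -> (e_ F i <= e_ F i.+1)%R.
Proof.
move=> iU.
have le (S : {set U}) : #|S| = i.+1 -> (e_ F i <= (edges_meeting S)%:Z - 1)%R.
  move=> Si; have /card_gt0P[x xS] : 0 < #|S| by rewrite Si.
  have Sx : #|S :\ x| = i by have := cardsD1 x S; rewrite xS Si => -[].
  rewrite -Sx (le_trans (e_le _)) // lerD2r lez_nat subset_leq_card //.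
  apply: setDS; apply/subsetP => d; rewrite !inE => /andP[-> /= dS].
  by apply: subset_trans dS _; rewrite setCS subsetDl.
(* Any set of this size bounds the minimum defining [e_ F i] by [#|edges F|], as [e_ge] requires. *)
have [S SU] : exists S : {set U}, #|S| = i.+1.
  exists [set x in take i.+1 (enum U)].
  rewrite cardsE; have /card_uniqP -> := take_uniq i.+1 (enum_uniq U).
  by rewrite size_takel // -cardE.
have ei : (e_ F i = (\big[minn/#|edges F|]_(S : {set U} | #|S| == i)
    edges_meeting S)%:Z - 1)%R by [].
move: le; rewrite ei => le.
have := @e_ge i.+1 (\big[minn/#|edges F|]_(S : {set U} | #|S| == i)
    edges_meeting S); apply.
  by have := le _ SU; rewrite lerD2r lez_nat => /leq_trans; apply; rewrite subset_leq_card ?subsetDl.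
by move=> S' /le; rewrite lerD2r lez_nat.
Qed.

(** Lower the first part of an optimal list by 1: a part 1 disappears at no loss by [e_ge0], a
    larger part gets no dearer by [e_mono]. *)
Lemma gstar_mono (r i j : nat) : r < #|U| -> i <= j -> (gstar F r i <= gstar F r j)%R.
Proof.
move=> rU; elim: j => [|j IH]; first by rewrite leqn0 => /eqP->.
rewrite leq_eqVlt => /predU1P[-> //|/IH{IH}/le_trans]; apply.
case: (gstar_attained j.+1 rU) => -[[]//|x w [adw sw ->]].
have U0 : 0 < #|U| by apply: leq_ltn_trans rU.
move: adw sw; rewrite /admissible /= => /andP[/andP[x0 xU] adw] sw.
rewrite big_cons; case: x => [//|[|x]] in x0 xU sw *.
  have <- : sumn w = j by lia.
  by rewrite (le_trans (gstar_le adw)) // lerDr e_ge0.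
have <- : sumn (x.+1 :: w) = j by rewrite /=; lia.
have adx : admissible r (x.+1 :: w) by rewrite /admissible /= adw andbT ltnW.
rewrite (le_trans (gstar_le adx)) // big_cons lerD2r e_mono //; apply: leq_trans xU (leq_subr _ _).
Qed.

End PartsOptimum.

(** * Lower bound *)

Section LowerBound.
Variables (U : finType) (F : sgraph U) (r : nat).
Hypothesis no_isolated : forall u, exists2 d, d \in edges F & u \in d.
Hypothesis r_le2 : r <= 2.
Hypothesis U_gt2 : 2 < #|U|.

(** The function h of the overview. Sets of a cover have at least [#|U|] elements, so the
    subtraction is not truncated on them. *)
Definition clique_cost (m : nat) : int :=
  (gstar F r (m - #|U|) + #|edges F|%:Z - 1)%R.

Let rU : r < #|U|. Proof. exact: leq_ltn_trans U_gt2. Qed.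

Lemma edges_gt0 : 0 < #|edges F|.
Proof.
have /card_gt0P[u _] : 0 < #|U| by apply: leq_ltn_trans U_gt2.
by have [d dF _] := no_isolated u; apply/card_gt0P; exists d.
Qed.

Lemma clique_cost_ge0 (m : nat) : (0 <= clique_cost m)%R.
Proof.
have := gstar_ge0 (F := F) no_isolated (m - #|U|) rU; have := edges_gt0.
rewrite /clique_cost; lia.
Qed.

(** * Merging the blocks that meet a copy of F *)

Section Merging.
Variables (T : finType) (f : U -> T).
Hypothesis f_inj : injective f.

(** As [del_edges] keeps the edges that avoid its argument, the complement yields the edges of F
    that [f] maps inside [Y]. *)
Definition inner_edges (Y : {set T}) : nat := #|del_edges F (~: (f @^-1: Y))|.

Definition engulfs (Y : {set T}) : bool := f @^-1: Y == setT.

(** With S the trace of [Y] and v the order of F, [W] and [Y] share at least |S| elements, so the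
    new excess over v is at most (|W| - v) + (|Y| - v) + (v - |S|), and [gstar] is monotone and
    subadditive. Since |S| >= 2 >= r, the last summand is an admissible part unless it is 0. A part
    0 would cost -1 whereas [gstar F r 0] is 0; the term [engulfs] makes up for this difference. *)
Lemma clique_cost_merge (W Y : {set T}) :
    f @: setT \subset W -> #|U| <= #|Y| -> 1 < #|f @^-1: Y| ->
  (clique_cost #|W :|: Y| <=
   clique_cost #|W| + (clique_cost #|Y| - (inner_edges Y)%:Z + (engulfs Y)%:Z))%R.
Proof.
move=> fW UY S2; set S := f @^-1: Y in S2 *.
have UW : #|U| <= #|W|.
  by rewrite -cardsT -(card_imset _ f_inj) subset_leq_card.
have SU : #|S| <= #|U| by rewrite max_card.
have WY : #|W :|: Y| + #|S| <= #|W| + #|Y|.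
  rewrite -cardsUI leq_add2l -(card_imset _ f_inj) subset_leq_card //.
  rewrite subsetI (subset_trans (imsetS f (subsetT S)) fW) /=.
  by apply/subsetP => _ /imsetP[u + ->]; rewrite inE.
rewrite /clique_cost.
have gW : (gstar F r (#|W :|: Y| - #|U|) <= gstar F r (#|W| - #|U|) +
    (gstar F r (#|Y| - #|U|) + gstar F r (#|U| - #|S|)))%R.
  have sub i j := gstar_subadditive F i j rU.
  apply: le_trans (le_trans (sub _ _) (lerD (lexx _) (sub _ _))).
  apply: gstar_mono => //; lia.
rewrite /engulfs -/S; have [ST|SnT] := eqVneq S setT.
  move: gW; rewrite /inner_edges -/S ST cardsT subnn gstar0 => gW.
  have := subset_leq_card (del_edges_sub F (~: setT)); lia.
have SltU : #|S| < #|U| by rewrite -cardsT proper_card // properT.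
have gS : (gstar F r (#|U| - #|S|) <= e_ F (#|U| - #|S|))%R.
  by apply: gstar_le_e; lia.
have := e_le F (~: S); rewrite cardsCs setCK => eS.
have := edges_meeting_del F (~: S); rewrite /inner_edges -/S; lia.
Qed.

Definition merge (P : seq {set T}) : {set T} :=
  foldr (fun Y W => W :|: Y) (f @: setT) P.

Lemma merge_image_sub (P : seq {set T}) : f @: setT \subset merge P.
Proof. by elim: P => //= Y P IH; apply: subset_trans IH (subsetUl _ _). Qed.

Lemma merge_sub (P : seq {set T}) (Y : {set T}) : Y \in P -> Y \subset merge P.
Proof.
elim: P => //= Z P IH; rewrite inE => /predU1P[->|/IH YP].
  exact: subsetUr.
exact: subset_trans YP (subsetUl _ _).
Qed.

Lemma clique_cost_merge_all (P : seq {set T}) :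
    all (fun Y : {set T} => (#|U| <= #|Y|) && (1 < #|f @^-1: Y|)) P ->
  (clique_cost #|merge P| <= #|edges F|%:Z - 1 +
   \sum_(Y <- P) (clique_cost #|Y| - (inner_edges Y)%:Z + (engulfs Y)%:Z))%R.
Proof.
elim: P => /= [_|Y P IH /andP[/andP[UY S2] /IH leP]].
  by rewrite big_nil addr0 card_imset // cardsT /clique_cost subnn gstar0 add0r.
rewrite big_cons; have := clique_cost_merge (merge_image_sub P) UY S2; lia.
Qed.

End Merging.

(** * The potential of a cover *)

Section Potential.
Variable T : finType.

Definition covered (P : seq {set T}) (e : {set T}) : bool :=
  has (fun Y : {set T} => e \subset Y) P.

Definition uncovered (P : seq {set T}) (E : {set {set T}}) : {set {set T}} :=
  [set e in E | ~~ covered P e].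

Definition potential (P : seq {set T}) (E : {set {set T}}) : int :=
  (\sum_(Y <- P) clique_cost #|Y| + #|uncovered P E|%:Z)%R.

Definition large (P : seq {set T}) : bool :=
  all (fun Y : {set T} => #|U| <= #|Y|) P.

(** A union bound; blocks meeting the copy in at most one vertex contain none of its edges. *)
Lemma covered_count (f : U -> T) (P : seq {set T}) :
  #|[set d in edges F | covered P (f @: d)]| <=
  \sum_(Y <- P | 1 < #|f @^-1: Y|) inner_edges f Y.
Proof.
elim: P => [|Y P IH].
  by rewrite big_nil leqn0 cards_eq0; apply/eqP/setP => d; rewrite !inE andbF.
rewrite big_cons.
have -> : [set d in edges F | covered (Y :: P) (f @: d)] =
  del_edges F (~: (f @^-1: Y)) :|: [set d in edges F | covered P (f @: d)].
  by apply/setP => d; rewrite !inE /= setCK sub_imset_pre; case: (d \in edges F).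
rewrite (leq_trans (leq_card_setU _ _)) //.
case: ifP => [_|S1]; first exact: leq_add.
suff -> : del_edges F (~: (f @^-1: Y)) = set0 by rewrite cards0.
apply/setP => d; rewrite !inE setCK; apply/negP => /andP[dF /subset_leq_card].
by have /subsetP/(_ d dF) := edges_pairs F; rewrite inE => /eqP ->; rewrite S1.
Qed.

(** The new cover consists of the merged set and the blocks meeting the copy in at most one vertex.
    It serves both for following a bootstrap step and for lowering the potential of the complete
    graph. *)
Lemma potential_merge (f : U -> T) (P : seq {set T}) :
    injective f -> large P ->
  exists P', [/\ large P', forall d : {set U}, covered P' (f @: d) &
    forall E, (potential P' E + #|[set d in edges F | (f @: d \in E) &&
        ~~ covered P (f @: d)]|%:Z
      <= potential P E + (#|edges F|%:Z - 1 +
          \sum_(Y <- P | (1 < #|f @^-1: Y|)%N) ((engulfs f Y)%:Z - (inner_edges f Y)%:Z)))%R].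
Proof.
move=> f_inj bigP; pose hit (Y : {set T}) := 1 < #|f @^-1: Y|.
pose P1 := filter hit P; pose P2 := filter (predC hit) P.
have bigP1 : all (fun Y : {set T} => (#|U| <= #|Y|) && hit Y) P1.
  apply/allP => Y; rewrite mem_filter => /andP[-> YP].
  by rewrite (allP bigP Y YP).
have covd (d : {set U}) : covered (merge f P1 :: P2) (f @: d).
  rewrite /covered /= (subset_trans _ (merge_image_sub f P1)) //.
  exact: imsetS (subsetT d).
exists (merge f P1 :: P2); split => // [|E].
  rewrite /large /= -cardsT -(card_imset _ f_inj) subset_leq_card ?merge_image_sub //=.
  by apply/allP => Y; rewrite mem_filter => /andP[_ YP]; rewrite card_imset // cardsT (allP bigP).
have := clique_cost_merge_all f_inj bigP1.
have -> : (\sum_(Y <- P1) (clique_cost #|Y| - (inner_edges f Y)%:Z + (engulfs f Y)%:Z) =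
    \sum_(Y <- P | hit Y) clique_cost #|Y| +
    \sum_(Y <- P | hit Y) ((engulfs f Y)%:Z - (inner_edges f Y)%:Z))%R.
  by rewrite big_filter -big_split; apply: eq_bigr => Y _ /=; lia.
rewrite /potential big_cons [X in (X + #|uncovered P E|%:Z)%R](bigID hit) /= big_filter.
set s1 : int := (\sum_(_ <- _ | _) _)%R; set s2 : int := (\sum_(_ <- _ | _) (_ - _))%R.
set s3 : int := (\sum_(_ <- _ | ~~ _) _)%R; rewrite -[X in (_ <= _ + (_ + X))%R]/s2.
have covP e : covered P e -> covered (merge f P1 :: P2) e.
  case/hasP => Y YP eY; apply/hasP; have [hY|hY] := boolP (hit Y).
    exists (merge f P1); first by rewrite mem_head.
    by apply: subset_trans eY (merge_sub f _); rewrite mem_filter hY.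
  by exists Y => //; rewrite inE mem_filter /= hY YP orbT.
set D := [set d in edges F | _].
suff : #|uncovered (merge f P1 :: P2) E| + #|D| <= #|uncovered P E|.
  by move: (clique_cost _) #|D| #|uncovered _ _| #|uncovered _ _| s1 s2 s3; lia.
rewrite -(card_imset D (imset_inj f_inj)).
set D' := _ @: D.
(* The edges of the copy counted by [D] were uncovered and are now covered, so they leave the
   uncovered part. *)
have disj : uncovered (merge f P1 :: P2) E :&: D' = set0.
  apply/setP => e; rewrite in_setI in_set0; apply/negP.
  by case/andP; rewrite inE => /andP[_ /negP nc] /imsetP[d _ de]; apply: nc; rewrite de.
rewrite -cardsUI disj cards0 addn0 subset_leq_card // subUset.
apply/andP; split; apply/subsetP => e.
  by rewrite !inE => /andP[-> /=]; apply: contra => /covP.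
by case/imsetP => d; rewrite !inE => /and3P[_ dE dc] ->; rewrite dE.
Qed.

(** If the new edge is covered, nothing changes. Otherwise no block engulfs the copy, and every edge
    of F other than [d0] is either covered, hence paid for by [inner_edges], or a single edge of
    cost 1 that merging saves; [d0] accounts for the -1. *)
Lemma potential_step (f : U -> T) (P : seq {set T}) (E : {set {set T}}) (d0 : {set U}) :
    injective f -> large P -> d0 \in edges F ->
    (forall d, d \in edges F -> d != d0 -> f @: d \in E) ->
  exists2 P', large P' & (potential P' (f @: d0 |: E) <= potential P E)%R.
Proof.
move=> f_inj bigP d0F dE; have [cov0|ncov0] := boolP (covered P (f @: d0)).
  exists P => //; rewrite lerD2l lez_nat subset_leq_card //; apply/subsetP => e.
  by rewrite !inE; case: eqP => [->|]; rewrite ?cov0 ?andbF.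
have [P' [bigP' cov' /(_ E) le']] := potential_merge f_inj bigP.
exists P' => //.
have uncE : uncovered P' (f @: d0 |: E) \subset uncovered P' E.
  by apply/subsetP => e; rewrite !inE; case: eqP => [->|]; rewrite ?cov' ?andbF.
have := subset_leq_card uncE.
have not_engulfed : (\sum_(Y <- P | (1 < #|f @^-1: Y|)%N)
    ((engulfs f Y)%:Z - (inner_edges f Y)%:Z) =
    - (\sum_(Y <- P | (1 < #|f @^-1: Y|)%N) inner_edges f Y)%N%:Z)%R.
  rewrite (big_morph Posz PoszD (erefl _)) -sumrN big_seq_cond [RHS]big_seq_cond.
  apply: eq_bigr => Y /andP[YP _]; rewrite /engulfs; case: eqP => [YT|_]; last by rewrite add0r.
  by case/hasP: ncov0; exists Y => //; rewrite sub_imset_pre YT subsetT.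
have := covered_count f P; move: le'; rewrite not_engulfed /potential.
set D := [set d in _ | _ && _]; set C := [set d in _ | covered _ _].
have : #|edges F| <= #|C| + #|D| + 1.
  have /subset_leq_card/leq_trans : edges F \subset C :|: D :|: [set d0].
    apply/subsetP => d dF; rewrite !inE dF /=.
    by have [|nd0] := eqVneq d d0; rewrite ?orbT // (dE d dF nd0) /= orbN.
  apply; rewrite (leq_trans (leq_card_setU _ _)) // cards1 leq_add2r.
  exact: leq_card_setU.
by set s := (\sum_(_ <- _ | _) _)%N; lia.
Qed.

Lemma inner_edges_engulfs (f : U -> T) (Y : {set T}) :
  engulfs f Y -> inner_edges f Y = #|edges F|.
Proof.
move=> /eqP fY; rewrite /inner_edges fY; apply: eq_card => d.
by rewrite !inE setCK subsetT andbT.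
Qed.

Lemma inner_excess_ge0 (f : U -> T) (Y : {set T}) :
  (0 <= (inner_edges f Y)%:Z - (engulfs f Y)%:Z)%R.
Proof.
have := edges_gt0; case: (boolP (engulfs f Y)) => [/inner_edges_engulfs ->|_]; lia.
Qed.

Lemma exists_injection (A : {set T}) :
  #|U| <= #|A| -> exists2 f : U -> T, injective f & forall u, f u \in A.
Proof.
move=> UA; have rankA (u : U) : enum_rank u < size (enum A) by rewrite -cardE (leq_trans (ltn_ord (enum_rank u))).
have /card_gt0P[x0 _] : 0 < #|A| by apply: leq_trans UA; apply: leq_trans U_gt2.
exists (fun u => nth x0 (enum A) (enum_rank u)) => [u u' /eqP|u].
  by rewrite nth_uniq ?enum_uniq // => /eqP/val_inj/enum_rank_inj.
by rewrite -mem_enum mem_nth.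
Qed.

(** An edge misses one of the at least three vertices. In [potential_drop] that vertex is placed
    outside a block while the edge stays inside. *)
Lemma edge_avoiding_vertex : exists u, exists2 d, d \in edges F & u \notin d.
Proof.
have /card_gt0P[d dF] := edges_gt0.
have [u ud] : exists u, u \in ~: d.
  apply/card_gt0P; rewrite cardsCs setCK subn_gt0.
  by have /subsetP/(_ d dF) := edges_pairs F; rewrite inE => /eqP ->.
by exists u, d; rewrite // -in_setC.
Qed.

Lemma mem_edges_complete (e : {set T}) : (e \in edges (complete T)) = (#|e| == 2).
Proof.
apply/idP/idP => [eK|/cards2P[x [y [xy ->]]]].
  by have /subsetP/(_ e eK) := edges_pairs (complete T); rewrite inE.
by apply/imsetP; exists (x, y); rewrite ?inE /= ?xy.
Qed.

(* The copy of F is placed so that it meets some block Y in all but one vertex;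
   blocks containing the whole copy lose nothing, as each accounts for all
   the edges of F at once. *)
Lemma potential_drop (P : seq {set T}) :
    large P -> #|U| <= #|T| -> setT \notin P ->
  exists2 P', large P' &
    (potential P' (edges (complete T)) <= potential P (edges (complete T)) - 1)%R.
Proof.
move=> bigP UT PnT.
(* In the complete graph every edge of the copy is covered or counted by [D], so merging gains 1 as
   soon as the covered edges are outweighed by the sum of the excesses. *)
suff [f f_inj excess] : exists2 f : U -> T, injective f &
    (#|[set d in edges F | covered P (f @: d)]|%:Z <=
     \sum_(Y <- P | (1 < #|f @^-1: Y|)%N) ((inner_edges f Y)%:Z - (engulfs f Y)%:Z))%R.
  have [P' [bigP' _ /(_ (edges (complete T))) le']] := potential_merge f_inj bigP.
  exists P' => //; move: le' excess.
  have -> : (\sum_(Y <- P | (1 < #|f @^-1: Y|)%N) ((inner_edges f Y)%:Z - (engulfs f Y)%:Z) =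
      - \sum_(Y <- P | (1 < #|f @^-1: Y|)%N) ((engulfs f Y)%:Z - (inner_edges f Y)%:Z))%R.
    by rewrite -sumrN; apply: eq_bigr => Y _; rewrite opprB.
  set D := [set d in edges F | _ && _]; set C := [set d in edges F | _].
  suff : #|edges F| <= #|C| + #|D|.
    by move: (potential _ _) (potential _ _) (\sum_(_ <- _ | _) _)%R #|C| #|D|; lia.
  have /subset_leq_card/leq_trans : edges F \subset C :|: D.
    apply/subsetP => d dF; rewrite !inE dF mem_edges_complete card_imset //=.
    by have /subsetP/(_ d dF) := edges_pairs F; rewrite inE => -> /=; rewrite orbN.
  by apply; apply: leq_card_setU.
case: P bigP PnT => [_ _|Y P /andP[UY _]].
  have [|f f_inj _] := @exists_injection setT; first by rewrite cardsT.
  exists f => //; rewrite big_nil lez_nat leqn0 cards_eq0.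
  by apply/eqP/setP => d; rewrite !inE andbF.
rewrite inE negb_or eq_sym -properT => /andP[/properP[_ [x _ xY]] _].
have [g g_inj gY] := exists_injection UY.
have [u0 [d0 d0F u0d]] := edge_avoiding_vertex.
pose f u := if u == u0 then x else g u.
have fY : f @^-1: Y = [set~ u0].
  by apply/setP => u; rewrite !inE /f; case: (u == u0); rewrite ?gY ?(negPf xY).
exists f => [u u'|].
  rewrite /f; have [->|_] := eqVneq u u0; have [->|_] := eqVneq u' u0 => //.
  - by move=> xg; case/negP: xY; rewrite xg gY.
  - by move=> gx; case/negP: xY; rewrite -gx gY.
  - exact: g_inj.
have hitY : 1 < #|f @^-1: Y| by rewrite fY cardsC1; lia.
have engY : engulfs f Y = false.
  by apply/negP => /eqP/setP/(_ u0); rewrite fY !inE eqxx.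
have inY : 0 < inner_edges f Y.
  apply/card_gt0P; exists d0; rewrite !inE d0F setCK fY /=.
  by apply/subsetP => u ud; rewrite !inE; apply: contraNneq u0d => <-.
rewrite big_cons hitY engY.
(* An engulfing block contributes l - 1 and [Y] at least 1, which pays for all l edges of the copy;
   without such a block [covered_count] suffices. *)
have [/hasP[Z ZP engZ]|no_eng] := boolP (has (engulfs f) P).
  have -> /= : (\sum_(X <- P | (1 < #|f @^-1: X|)%N) ((inner_edges f X)%:Z - (engulfs f X)%:Z) =
      #|edges F|%:Z - 1 + \sum_(X <- rem Z P | (1 < #|f @^-1: X|)%N)
        ((inner_edges f X)%:Z - (engulfs f X)%:Z))%R.
    rewrite (big_rem Z ZP) /= (inner_edges_engulfs engZ) engZ (eqP engZ) cardsT.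
    by rewrite (ltnW U_gt2).
  have : (0 <= \sum_(X <- rem Z P | (1 < #|f @^-1: X|)%N)
      ((inner_edges f X)%:Z - (engulfs f X)%:Z))%R.
    by apply: sumr_ge0 => X _; apply: inner_excess_ge0.
  have : #|[set d in edges F | covered (Y :: P) (f @: d)]| <= #|edges F|.
    by apply/subset_leq_card/subsetP => d; rewrite inE => /andP[].
  set C := #|[set _ in _ | _]|; set s : int := (\sum_(_ <- _ | _) _)%R.
  by move: C s (inner_edges f Y) #|edges F| inY; lia.
have -> : (\sum_(X <- P | (1 < #|f @^-1: X|)%N) ((inner_edges f X)%:Z - (engulfs f X)%:Z) =
    (\sum_(X <- P | 1 < #|f @^-1: X|) inner_edges f X)%N%:Z)%R.
  rewrite (big_morph Posz PoszD (erefl _)) big_seq_cond [RHS]big_seq_cond.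
  apply: eq_bigr => X /andP[XP _].
  by rewrite (negPf (hasPn no_eng X XP)) subr0.
have := covered_count f (Y :: P); rewrite big_cons hitY.
set C := #|[set _ in _ | _]|; set s := (\sum_(_ <- _ | _) _)%N.
by move: C s (inner_edges f Y); lia.
Qed.

(** The potential is a nonnegative integer, so [potential_drop] can be repeated only finitely often;
    it stops when the whole vertex set is a block, whose cost is one summand. *)
Lemma potential_complete_ge (P : seq {set T}) :
    large P -> #|U| <= #|T| ->
  (clique_cost #|T| <= potential P (edges (complete T)))%R.
Proof.
move=> + UT; have cost_ge0 (Q : seq {set T}) : (0 <= \sum_(Y <- Q) clique_cost #|Y|)%R.
  by apply: sumr_ge0 => Y _; apply: clique_cost_ge0.
have [n] : exists n : nat, (potential P (edges (complete T)) <= n%:Z)%R.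
  exists `|potential P (edges (complete T))|%N.
  by rewrite gez0_abs // /potential addr_ge0.
elim: n P => [|n IH] P leP bigP; have [TP|nTP] := boolP (setT \in P).
- rewrite /potential (big_rem _ TP) /= cardsT -addrA lerDl addr_ge0 //.
- have [P' _] := potential_drop bigP UT nTP; have := cost_ge0 P'.
  by move: leP; rewrite /potential; lia.
- rewrite /potential (big_rem _ TP) /= cardsT -addrA lerDl addr_ge0 //.
have [P' bigP' leP'] := potential_drop bigP UT nTP.
have : (clique_cost #|T| <= potential P' (edges (complete T)))%R by apply: IH => //; lia.
lia.
Qed.

(** Start from the empty cover, where the potential is the number of edges, and follow the process
    with [potential_step]. *)
Lemma potential_connect (H G : sgraph T) :
    connect (@bootstrap_step U F T) H G ->
  exists2 P, large P & (potential P (edges G) <= #|edges H|%:Z)%R.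
Proof.
case/connectP => p + ->; elim/last_ind: p => [_|p G' IH] /=.
  exists [::] => //; rewrite /potential big_nil add0r lez_nat.
  by rewrite subset_leq_card //; apply/subsetP => e; rewrite inE => /andP[].
rewrite rcons_path last_rcons => /andP[/IH[P bigP leP] /existsP[e]].
case/and3P=> eG /eqP EG' /existsP[f /and3P[/injectiveP f_inj fF /imsetP[d0 d0F ee]]].
have [|P' bigP' leP'] := potential_step f_inj bigP d0F (E := edges (last H p)).
  move=> d dF dd0; have := subsetP fF (f @: d) (imset_f _ dF).
  by rewrite EG' in_setU1 ee (inj_eq (imset_inj f_inj)) (negPf dd0).
by exists P' => //; rewrite EG' ee (le_trans leP').
Qed.

Lemma weakly_saturated_ge (H : sgraph T) :
    #|U| <= #|T| -> weakly_saturated F H ->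
  (clique_cost #|T| <= #|edges H|%:Z)%R.
Proof.
move=> UT /potential_connect[P bigP]; apply: le_trans.
exact: potential_complete_ge.
Qed.

End Potential.

Lemma wsat_ge (n : nat) :
  #|U| <= n -> (gstar F r (n - #|U|) + #|edges F|%:Z - 1 <= (wsat F n)%:Z)%R.
Proof.
move=> Un; rewrite /wsat; case: arg_minnP => [|H satH _]; first exact: connect0.
by have := @weakly_saturated_ge 'I_n H; rewrite card_ord; apply.
Qed.

End LowerBound.

(** * Graphs closed under bootstrap steps *)

Section Stability.
Variables (U : finType) (F : sgraph U) (T : finType).

Definition stable (G : sgraph T) : Prop :=
  forall (f : U -> T) (d0 : {set U}), injective f -> d0 \in edges F ->
    (forall d, d \in edges F -> d != d0 -> f @: d \in edges G) ->
  f @: d0 \in edges G.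

Lemma connect_bootstrap_sub (H G : sgraph T) :
  connect (@bootstrap_step U F T) H G -> edges H \subset edges G.
Proof.
case/connectP => p + ->; elim/last_ind: p => //= p G' IH.
rewrite rcons_path last_rcons => /andP[/IH subG /existsP[e /and3P[_ /eqP -> _]]].
exact: subset_trans subG (subsetUr _ _).
Qed.

(** A reachable graph with the most edges is stable, as a missing edge of a copy would allow one
    more step. *)
Lemma stable_closure (H : sgraph T) :
  exists2 G, connect (@bootstrap_step U F T) H G & stable G.
Proof.
pose reach := connect (@bootstrap_step U F T) H.
have reachH : reach H by apply: connect0.
case: (arg_maxnP (fun G => #|edges G|) reachH) => G HG maxG.
exists G => // f d0 f_inj d0F fd; apply/negPn/negP => ndG.
have pairsG' : f @: d0 |: edges G \subset [set e : {set T} | #|e| == 2].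
  rewrite subUset sub1set inE card_imset // (edges_pairs G) andbT.
  by have /subsetP/(_ d0 d0F) := edges_pairs F; rewrite inE.
have step : bootstrap_step F G (SGraph pairsG').
  apply/existsP; exists (f @: d0); rewrite ndG eqxx /=.
  apply/existsP; exists [ffun u => f u].
  have ffE (d : {set U}) : [ffun u => f u] @: d = f @: d.
    by apply: eq_imset => u; rewrite ffunE.
  apply/and3P; split.
  - by apply/injectiveP => u u'; rewrite !ffunE => /f_inj.
  - apply/subsetP => _ /imsetP[d dF ->]; rewrite ffE in_setU1.
    by have [->|nd] := eqVneq d d0; rewrite ?eqxx // fd ?orbT.
  - by rewrite -ffE imset_f.
have := maxG _ (connect_trans HG (connect1 step)).
by rewrite /= cardsU1 ndG /= add1n ltnn.
Qed.

Definition clique_on (G : sgraph T) (s : seq T) : Prop :=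
  forall x y, x \in s -> y \in s -> x != y -> [set x; y] \in edges G.

(** Quantifying over all stable graphs containing [E0] lets constructions be composed without
    ordering the steps of a process. *)
Definition spannable (m : nat) (z : int) : Prop :=
  forall s : seq T, uniq s -> size s = m ->
    exists E0 : {set {set T}}, [/\ E0 \subset [set e : {set T} | #|e| == 2],
      (#|E0|%:Z <= z)%R &
      forall G, stable G -> E0 \subset edges G -> clique_on G s].

Lemma spannable_mono (m : nat) (z z' : int) :
  (z <= z')%R -> spannable m z -> spannable m z'.
Proof.
move=> zz' span s us ss; have [E0 [pE cE gE]] := span s us ss.
by exists E0; split => //; apply: le_trans zz'.
Qed.

End Stability.

(** The stable closure of the spanning edge set is the complete graph. *)
Lemma wsat_le (U : finType) (F : sgraph U) (n : nat) (z : int) :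
  spannable F 'I_n n z -> ((wsat F n)%:Z <= z)%R.
Proof.
move=> /(_ (enum 'I_n) (enum_uniq _))[|E0 [pE cE gE]]; first by rewrite size_enum_ord.
apply: le_trans cE; rewrite lez_nat /wsat.
case: arg_minnP => [|H _ minH]; first exact: connect0.
apply: (minH (SGraph pE)); have [G cG sG] := stable_closure F (SGraph pE).
suff KG : complete 'I_n = G by rewrite /weakly_saturated KG.
apply/val_inj/eqP; rewrite /= eqEsubset; apply/andP; split; apply/subsetP => e eG.
  move: eG; rewrite mem_edges_complete => /cards2P[x [y [xy ->]]].
  by apply: (gE G sG) xy; rewrite ?mem_enum // (connect_bootstrap_sub cG).
by rewrite mem_edges_complete; have /subsetP/(_ e eG) := edges_pairs G; rewrite inE.
Qed.

(** * Moving the links of a dumbbell *)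

Section Dumbbell.
Variables (a b c : nat).
Hypotheses (hc : 0 < c) (hca : c <= a) (hcb : c <= b).

Let U : finType := ('I_a + 'I_b)%type.
Let F : sgraph U := dumbbell a b c.
Let linkA (k : 'I_c) : 'I_a := widen_ord hca k.
Let linkB (k : 'I_c) : 'I_b := widen_ord hcb k.

Lemma dumbbell_edgeP (d : {set U}) :
  reflect [\/ exists i j : 'I_a, i != j /\ d = [set inl i; inl j],
              exists i j : 'I_b, i != j /\ d = [set inr i; inr j] |
              exists k : 'I_c, d = [set inl (linkA k); inr (linkB k)]]
          (d \in edges F).
Proof.
apply: (iffP idP) => [/imsetP[[[i|i] [j|j]] /andP[/= ne rij] ->]|].
- by apply: Or31; exists i, j.
- case/andP: rij => /eqP ij ic; apply: Or33; exists (Ordinal ic).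
  by congr [set inl _; inr _]; apply: val_inj => /=.
- by [].
- by apply: Or32; exists i, j.
case=> [[i [j [ij ->]]]|[i [j [ij ->]]]|[k ->]]; apply/imsetP.
- by exists (inl i, inl j); rewrite ?inE /= ?andbT.
- by exists (inr i, inr j); rewrite ?inE /= ?andbT.
- by exists (inl (linkA k), inr (linkB k)); rewrite ?inE //= eqxx /=.
Qed.

(** * Filling in all edges between two cliques *)

Section Crossing.
Variables (T : finType) (G : sgraph T).
Hypothesis G_stable : stable F G.
Variables (Q R : {set T}).
Hypothesis QR : [disjoint Q & R].
Hypothesis Q_clique : forall x y, x \in Q -> y \in Q -> x != y -> [set x; y] \in edges G.
Hypothesis R_clique : forall x y, x \in R -> y \in R -> x != y -> [set x; y] \in edges G.

Let tperm_mem (A : {set T}) (x y z : T) :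
  x \in A -> y \in A -> z \in A -> tperm x y z \in A.
Proof. by case: tpermP. Qed.

(** Composing [q] and [p] with transpositions moves the link [k0] to [x] and [y] and fixes the other
    links, so the edge sought is the only one the copy may lack. *)
Lemma link_forced (q : 'I_a -> T) (p : 'I_b -> T) (x y : T) (k0 : 'I_c) :
    injective q -> injective p -> (forall i, q i \in Q) -> (forall j, p j \in R) ->
    x \in Q -> y \in R ->
    (forall k, k != k0 -> [/\ x != q (linkA k), y != p (linkB k) &
       [set q (linkA k); p (linkB k)] \in edges G]) ->
  [set x; y] \in edges G.
Proof.
move=> q_inj p_inj qQ pR xQ yR other.
pose q' i := tperm x (q (linkA k0)) (q i); pose p' j := tperm y (p (linkB k0)) (p j).
have q'Q i : q' i \in Q by apply: tperm_mem.
have p'R j : p' j \in R by apply: tperm_mem.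
have q'_inj : injective q' by move=> i j /perm_inj/q_inj.
have p'_inj : injective p' by move=> i j /perm_inj/p_inj.
have QRne u w : u \in Q -> w \in R -> u != w.
  by move=> uQ wR; apply: contraTneq wR => <-; rewrite (disjointFr QR).
pose f (u : U) := match u with inl i => q' i | inr j => p' j end.
have fE u w : f @: [set u; w] = [set f u; f w] by rewrite imsetU1 imset_set1.
have f_inj : injective f.
  case=> i [] j /= => [/q'_inj -> // | e | e | /p'_inj -> //].
    by have := QRne _ _ (q'Q i) (p'R j); rewrite e eqxx.
  by have := QRne _ _ (q'Q j) (p'R i); rewrite e eqxx.
have -> : [set x; y] = f @: [set inl (linkA k0); inr (linkB k0)].
  by rewrite fE /= /q' /p' !tpermR.
apply: G_stable => // [|d /dumbbell_edgeP]; first by apply/dumbbell_edgeP/Or33; exists k0.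
case=> [[i [j [ij ->]]] _|[i [j [ij ->]]] _|[k ->] nk]; rewrite fE /=.
- by apply: Q_clique => //; apply: contraNneq ij => /q'_inj ->.
- by apply: R_clique => //; apply: contraNneq ij => /p'_inj ->.
have kk0 : k != k0 by apply: contraNneq nk => ->.
have [xk yk adj] := other k kk0; rewrite /q' /p' !tpermD //.
  by apply: contra_neq kk0 => /p_inj/(congr1 val)/= e; apply: val_inj.
by apply: contra_neq kk0 => /q_inj/(congr1 val)/= e; apply: val_inj.
Qed.

Variables (q : 'I_a -> T) (p : 'I_b -> T) (y0 : T).
Hypotheses (q_inj : injective q) (p_inj : injective p).
Hypotheses (qQ : forall i, q i \in Q) (pR : forall j, p j \in R).
Hypothesis linked : forall k, [set q (linkA k); p (linkB k)] \in edges G.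

Lemma link_spare (p' : 'I_b -> T) (x y : T) :
    injective p' -> (forall j, p' j \in R) ->
    (forall k, [set q (linkA k); p' (linkB k)] \in edges G) ->
    x \in Q -> y \in R -> (forall k, y != p' (linkB k)) ->
  [set x; y] \in edges G.
Proof.
move=> p'_inj p'R linked' xQ yR spare.
(* The link to be moved is the one at [x] if there is one, and an arbitrary one otherwise. *)
have [k0 xk0] : exists k0, forall k, k != k0 -> x != q (linkA k).
  have [/existsP[k0 /eqP xq]|/existsPn xq] := boolP [exists k, x == q (linkA k)].
    exists k0 => k; apply: contra_neq; rewrite xq => /q_inj/(congr1 val)/= e.
    exact/esym/val_inj.
  by exists (Ordinal hc) => k _; apply: xq.
by apply: (link_forced (k0 := k0) q_inj p'_inj) => // k kk0; split; auto.
Qed.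

(* To link x to the partner y of the k-th linked vertex of Q, first move that
   vertex's link to the spare vertex y0, which frees y. *)
Lemma crossing_complete (x y : T) :
    y0 \in R -> (forall k, y0 != p (linkB k)) -> x \in Q -> y \in R ->
  [set x; y] \in edges G.
Proof.
move=> y0R spare0 xQ yR.
have [/existsP[k0 /eqP yp]|/existsPn spare] := boolP [exists k, y == p (linkB k)];
  last exact: (link_spare p_inj).
pose p' j := tperm y y0 (p j).
have p'E k : k != k0 -> p' (linkB k) = p (linkB k).
  move=> kk0; rewrite /p' tpermD //.
  by rewrite yp; apply: contra_neq kk0 => /p_inj/(congr1 val)/= e; apply/esym/val_inj.
have p'k0 : p' (linkB k0) = y0 by rewrite /p' -yp tpermL.
have p'_inj : injective p' by move=> i j /perm_inj/p_inj.
apply: (link_spare p'_inj) => // [j|k|k]; first exact: tperm_mem.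
  have [->|/p'E-> //] := eqVneq k k0.
  by rewrite p'k0; apply: (link_spare p_inj).
have [->|kk0] := eqVneq k k0; first by rewrite p'k0 yp eq_sym.
by rewrite p'E // yp; apply: contra_neq kk0 => /p_inj/(congr1 val)/= e; apply/esym/val_inj.
Qed.

End Crossing.

(** The edges inside [W] split into pairs of left vertices, pairs of right vertices and links, told
    apart by the constructors of their ends. *)
Lemma card_del_edges_dumbbell (W : {set U}) :
  #|del_edges F (~: W)| = 'C(#|[set i | inl i \in W]|, 2) +
    'C(#|[set j | inr j \in W]|, 2) +
    #|[set k | (inl (linkA k) \in W) && (inr (linkB k) \in W)]|.
Proof.
set A := [set i | _]; set B := [set j | _]; set M := [set k | _].
pose EA := [set inl @: d | d : {set 'I_a} in [set d : {set 'I_a} | d \subset A & #|d| == 2]] : {set {set U}}.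
pose EB := [set inr @: d | d : {set 'I_b} in [set d : {set 'I_b} | d \subset B & #|d| == 2]] : {set {set U}}.
pose EM := [set [set inl (linkA k); inr (linkB k)] | k in M] : {set {set U}}.
have inl_i : injective (@inl 'I_a 'I_b) by move=> i j [].
have inr_i : injective (@inr 'I_a 'I_b) by move=> i j [].
have -> : del_edges F (~: W) = EA :|: EB :|: EM.
  apply/setP => d; rewrite !in_setU inE setCK; apply/andP/idP.
    case=> /dumbbell_edgeP[[i [j [ij ->]]]|[i [j [ij ->]]]|[k ->]] dW.
    - apply/orP; left; apply/orP; left; apply/imsetP; exists [set i; j].
        by rewrite inE cards2 ij andbT; move: dW; rewrite !subUset !sub1set !inE.
      by rewrite imsetU1 imset_set1.
    - apply/orP; left; apply/orP; right; apply/imsetP; exists [set i; j].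
        by rewrite inE cards2 ij andbT; move: dW; rewrite !subUset !sub1set !inE.
      by rewrite imsetU1 imset_set1.
    apply/orP; right; apply/imsetP; exists k => //.
    by move: dW; rewrite subUset !sub1set inE.
  case/orP => [/orP[]|] /imsetP[e + ->].
  - rewrite inE => /andP[+ /cards2P[i [j [ij ee]]]]; rewrite {e}ee.
    rewrite imsetU1 imset_set1 !subUset !sub1set !inE => ijW.
    by split=> //; apply/dumbbell_edgeP/Or31; exists i, j.
  - rewrite inE => /andP[+ /cards2P[i [j [ij ee]]]]; rewrite {e}ee.
    rewrite imsetU1 imset_set1 !subUset !sub1set !inE => ijW.
    by split=> //; apply/dumbbell_edgeP/Or32; exists i, j.
  rewrite subUset !sub1set inE => eW.
  by split=> //; apply/dumbbell_edgeP/Or33; exists e.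
have cEA : #|EA| = 'C(#|A|, 2) by rewrite card_imset ?cards_draws //; apply: imset_inj.
have cEB : #|EB| = 'C(#|B|, 2) by rewrite card_imset ?cards_draws //; apply: imset_inj.
have cEM : #|EM| = #|M|.
  rewrite card_imset // => k k' /setP/(_ (inl (linkA k))).
  rewrite !inE eqxx => /esym/orP[] /eqP // /inl_i/(congr1 val)/= e; exact: val_inj.
have noinr d j : d \in EA -> inr j \in d = false.
  by case/imsetP => e _ ->; apply/imsetP => -[].
have noinl d i : d \in EB -> inl i \in d = false.
  by case/imsetP => e _ ->; apply/imsetP => -[].
rewrite -cEA -cEB -cEM.
have disjAB : EA :&: EB = set0.
  apply/setP => d; rewrite in_setI in_set0; apply/negP => /andP[dA].
  case/imsetP => e; rewrite inE => /andP[_ /cards2P[i [j [_ ->]]]] de.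
  by have := noinr d i dA; rewrite de imset_f // !inE eqxx.
have disjM : (EA :|: EB) :&: EM = set0.
  apply/setP => d; rewrite in_setI in_set0 in_setU; apply/negP => /andP[+ /imsetP[k _ dk]].
  case/orP => [dA|dB].
    by have := noinr d (linkB k) dA; rewrite dk !inE eqxx ?orbT.
  by have := noinl d (linkA k) dB; rewrite dk !inE eqxx.
by rewrite cardsU disjM cards0 subn0 cardsU disjAB cards0 subn0.
Qed.

End Dumbbell.

(** * Extending cliques *)

Lemma card_ord_lt (n k : nat) : #|[set i : 'I_n | i < k]| = minn n k.
Proof.
rewrite -sum1dep_card big_mkcond; elim: n => [|n IH]; first by rewrite big_ord0 min0n.
by rewrite big_ord_recr /= IH; case: ifP; lia.
Qed.

Section Filling.
Variables (a b c : nat).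
Hypotheses (hc : 0 < c) (hca : c <= a) (hcb : c <= b).

Let U : finType := ('I_a + 'I_b)%type.
Let F : sgraph U := dumbbell a b c.

Lemma card_dumbbell_vertices : #|U| = a + b.
Proof. by rewrite card_sum !card_ord. Qed.

Lemma card_edges_dumbbell : #|edges F| = 'C(a, 2) + 'C(b, 2) + c.
Proof.
have -> : #|edges F| = #|del_edges F (~: setT)|.
  by apply: eq_card => d; rewrite !inE setCK subsetT andbT.
rewrite (card_del_edges_dumbbell hca hcb); congr ('C(_, 2) + 'C(_, 2) + _).
- by rewrite -[RHS]card_ord -cardsT; apply: eq_card => i; rewrite !inE.
- by rewrite -[RHS]card_ord -cardsT; apply: eq_card => i; rewrite !inE.
- by rewrite -[RHS]card_ord -cardsT; apply: eq_card => i; rewrite !inE.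
Qed.

Lemma dumbbell_no_isolated : 1 < b -> forall u : U, exists2 d, d \in edges F & u \in d.
Proof.
move=> b1 [i|j].
  have [a1|a1] := ltnP 1 a.
    have [j ij] : exists j : 'I_a, j != i.
      have [i0|i0] := eqVneq (val i) 0.
        by exists (Ordinal a1); apply/eqP => /(congr1 val) /=; rewrite i0.
      by exists (Ordinal (ltnW a1)); apply: contra_neq i0 => <-.
    exists [set inl i; inl j]; last by rewrite !inE eqxx.
    by apply/(dumbbell_edgeP hca hcb)/Or31; exists i, j; rewrite eq_sym.
  exists [set inl (widen_ord hca (Ordinal hc)); inr (widen_ord hcb (Ordinal hc))].
    by apply/(dumbbell_edgeP hca hcb)/Or33; exists (Ordinal hc).
  have -> : i = widen_ord hca (Ordinal hc) by apply: val_inj => /=; have := ltn_ord i; lia.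
  by rewrite !inE eqxx.
have [i ij] : exists i : 'I_b, i != j.
  have [j0|j0] := eqVneq (val j) 0.
    by exists (Ordinal b1); apply/eqP => /(congr1 val) /=; rewrite j0.
  by exists (Ordinal (ltnW b1)); apply: contra_neq j0 => <-.
exists [set inr j; inr i]; last by rewrite !inE eqxx.
by apply/(dumbbell_edgeP hca hcb)/Or32; exists j, i; rewrite eq_sym.
Qed.

(** * Placing a dumbbell along a list of vertices *)

Section Layout.
Variables (T : finType) (x0 : T) (s : seq T).
Hypotheses (s_uniq : uniq s) (s_size : a + b <= size s).

Definition layout (u : U) : T :=
  match u with inl i => nth x0 s i | inr j => nth x0 s (a + j) end.

Lemma layout_inj : injective layout.
Proof.
have lti (i : 'I_a) : i < size s by have := ltn_ord i; lia.
have ltj (j : 'I_b) : a + j < size s by have := ltn_ord j; lia.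
case=> i [] j /= /eqP; rewrite nth_uniq //.
- by move/eqP/val_inj->.
- by move/eqP => e; have := ltn_ord i; lia.
- by move/eqP => e; have := ltn_ord j; lia.
- by rewrite eqn_add2l => /eqP/val_inj->.
Qed.

(** The first [a] entries form the clique Q and the others the clique R. The entry at position
    [a + c] belongs to R and carries no link, hence is the spare vertex of [crossing_complete]. *)
Lemma layout_clique (G : sgraph T) :
    stable F G -> a + c < size s -> (forall d, d \in edges F -> layout @: d \in edges G) ->
    clique_on G (drop a s) ->
  clique_on G s.
Proof.
move=> G_stable acs FG cliqueR.
have fE u w : layout @: [set u; w] = [set layout u; layout w] by rewrite imsetU1 imset_set1.
pose Q := [set x in take a s]; pose R := [set x in drop a s].
have QR : [disjoint Q & R].
  have := s_uniq; rewrite -{1}(cat_take_drop a s) cat_uniq => /and3P[_ /hasPn nQR _].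
  rewrite -setI_eq0; apply/eqP/setP => x; rewrite !inE; apply/negP => /andP[xQ /nQR].
  by rewrite xQ.
have as_ : a <= size s by lia.
have nthQ (i : 'I_a) : nth x0 s i \in Q.
  by rewrite inE -(nth_take x0 (ltn_ord i)) mem_nth // size_takel // ltn_ord.
have nthR k : a + k < size s -> nth x0 s (a + k) \in R.
  by move=> ks; rewrite inE -nth_drop mem_nth // size_drop ltn_subRL.
have QnthP x : x \in Q -> exists i : 'I_a, x = nth x0 s i.
  rewrite inE => /(nthP x0)[i]; rewrite size_takel //.
  by move=> ia <-; exists (Ordinal ia); rewrite nth_take.
have Q_clique x y : x \in Q -> y \in Q -> x != y -> [set x; y] \in edges G.
  move=> /QnthP[i ->] /QnthP[j ->] ij.
  have := FG [set inl i; inl j]; rewrite fE; apply.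
  by apply/(dumbbell_edgeP hca hcb)/Or31; exists i, j; split=> //; apply: contraNneq ij => ->.
have R_clique x y : x \in R -> y \in R -> x != y -> [set x; y] \in edges G.
  by rewrite !inE; apply: cliqueR.
have ltj (j : 'I_b) : a + j < size s by have := ltn_ord j; lia.
have cross x y : x \in Q -> y \in R -> [set x; y] \in edges G.
  apply: (crossing_complete hc (hca := hca) (hcb := hcb) G_stable QR Q_clique R_clique
    (q := fun i => layout (inl i)) (p := fun j => layout (inr j)) (y0 := nth x0 s (a + c))).
  - by move=> i j /layout_inj[].
  - by move=> i j /layout_inj[].
  - by move=> i; apply: nthQ.
  - by move=> j; apply: nthR.
  - by move=> k; rewrite -fE FG //; apply/(dumbbell_edgeP hca hcb)/Or33; exists k.
  - exact: nthR.
  - move=> k /=; rewrite nth_uniq // ?eqn_add2l; first by rewrite neq_ltn ltn_ord orbT.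
    by apply: ltn_trans acs; rewrite ltn_add2l.
have memQR x : x \in s -> (x \in Q) || (x \in R).
  by rewrite -{1}(cat_take_drop a s) mem_cat !inE.
move=> x y /memQR/orP[xQ|xR] /memQR/orP[yQ|yR] xy.
- exact: Q_clique.
- exact: cross.
- by rewrite setUC cross.
- exact: R_clique.
Qed.

(* One of the edges of the copy meeting S is omitted: the copy supplies it. *)
Lemma span_extend (s' : seq T) (E' : {set {set T}}) (z : int) (S d0 : {set U}) :
    a + c < size s ->
    E' \subset [set e : {set T} | #|e| == 2] -> (#|E'|%:Z <= z)%R ->
    (forall G, stable F G -> E' \subset edges G -> clique_on G s') ->
    (forall u, u \notin S -> layout u \in s') ->
    d0 \in edges F -> ~~ (d0 \subset ~: S) ->
    {subset drop a s <= s'} \/ size s = a + b ->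
  exists E0 : {set {set T}}, [/\ E0 \subset [set e : {set T} | #|e| == 2],
    (#|E0|%:Z <= z + ((edges_meeting F S)%:Z - 1))%R &
    forall G, stable F G -> E0 \subset edges G -> clique_on G s].
Proof.
move=> acs pE' cE' gE' outS d0F d0S dropR.
pose D := (edges F :\: del_edges F S) :\ d0.
have d0M : d0 \in edges F :\: del_edges F S by rewrite !inE d0F (negPf d0S).
exists (E' :|: [set layout @: (d : {set U}) | d in D]); split.
- rewrite subUset pE'; apply/subsetP => _ /imsetP[d + ->]; rewrite !inE.
  case/and3P => _ _ dF; rewrite card_imset; last exact: layout_inj.
  by have /subsetP/(_ d dF) := edges_pairs F; rewrite inE.
- have cM : edges_meeting F S = #|D|.+1 by rewrite /edges_meeting (cardsD1 d0) d0M.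
  have [+ _] := leq_card_setU E' [set layout @: (d : {set U}) | d in D].
  rewrite cM (card_imset _ (imset_inj layout_inj)).
  by move: cE'; move: #|E'| #|D| #|_ :|: _|; lia.
move=> G G_stable; rewrite subUset => /andP[/(gE' G G_stable) cliqueS' /subsetP DG].
have FG0 d : d \in edges F -> d != d0 -> layout @: d \in edges G.
  move=> dF dd0; have [dS|dS] := boolP (d \subset ~: S); last first.
    by apply: DG; apply: imset_f; rewrite !inE dd0 dF (negPf dS).
  have /subsetP/(_ d dF) := edges_pairs F; rewrite inE => /cards2P[u [w [uw duw]]].
  move: dS; rewrite duw imsetU1 imset_set1 subUset !sub1set !inE => /andP[uS wS].
  apply: cliqueS'; try exact: outS.
  by apply: contraNneq uw => /layout_inj ->.
have FG d : d \in edges F -> layout @: d \in edges G.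
  have [->|dd0 dF] := eqVneq d d0; last exact: FG0.
  by move=> _; apply: G_stable => //; apply: layout_inj.
apply: layout_clique => // x y xR yR xy.
(* The entries after the first [a] form a clique either as part of [s'] or because they are exactly
   the right side of the copy. *)
case: dropR => [sub|ss]; first by apply: cliqueS' => //; apply: sub.
have RnthP w : w \in drop a s -> exists j : 'I_b, w = layout (inr j).
  move=> /(nthP x0)[j]; rewrite size_drop ss addKn => jb <-.
  by exists (Ordinal jb); rewrite nth_drop.
move: xR yR xy => /RnthP[i ->] /RnthP[j ->] ij.
have := FG [set inr i; inr j]; rewrite imsetU1 imset_set1; apply.
by apply/(dumbbell_edgeP hca hcb)/Or32; exists i, j; split=> //; apply: contraNneq ij => ->.
Qed.

End Layout.

(** Apply [span_extend] to the empty clique with all vertices new; [c < b] provides the spare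
    vertex. *)
Lemma spannable_base (T : finType) :
  c < b -> spannable F T (a + b) (#|edges F|%:Z - 1).
Proof.
move=> cb s us ss; have b1 : 1 < b by lia.
have x0 : T by case: s ss us => [|x //]; rewrite /=; lia.
have /card_gt0P[d0 d0F] : 0 < #|edges F| by rewrite card_edges_dumbbell; lia.
have [] := @span_extend T x0 s us (eq_leq (esym ss)) [::] set0 0 setT d0 => //.
- by rewrite ss ltn_add2l.
- exact: sub0set.
- by rewrite cards0.
- by move=> u; rewrite inE.
- rewrite setCT subset0; apply/eqP => d00.
  by have /subsetP/(_ d0 d0F) := edges_pairs F; rewrite inE d00 cards0.
- by right.
move=> E0 [pE0 cE0 gE0]; exists E0; split=> //.
apply: le_trans cE0 _; rewrite add0r lerD2r lez_nat.
by rewrite subset_leq_card // subsetDl.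
Qed.

(** The cost of attaching the last [j] vertices of the left side: links sit at the smallest indices,
    so [minn c (a - j)] of them survive. *)
Definition strip_cost (j : nat) : int :=
  (#|edges F|%:Z - ('C(a - j, 2) + 'C(b, 2) + minn c (a - j))%N%:Z - 1)%R.

Lemma spannable_strip (T : finType) (m j : nat) (z : int) :
    1 < b -> 0 < j <= a -> a + b <= m ->
  spannable F T m z -> spannable F T (m + j) (z + strip_cost j).
Proof.
move=> b1 /andP[j0 ja] abm span s us ss.
have x0 : T by case: s ss us => [|x //]; rewrite /=; lia.
(* The new vertices take the positions from [a - j] to [a - 1]; the rest of the list is the old
   clique. *)
pose s' := take (a - j) s ++ drop a s.
have us' : uniq s'.
  apply: subseq_uniq us; rewrite -[X in subseq _ X](cat_take_drop (a - j) s).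
  apply: cat_subseq => //; rewrite -[X in subseq (drop X _) _](subnKC ja) -drop_drop.
  exact: drop_subseq.
have ss' : size s' = m.
  by rewrite size_cat size_drop size_takel ss; lia.
have [E' [pE' cE' gE']] := span s' us' ss'.
pose S : {set U} := [set u : U |
  match u : ('I_a + 'I_b)%type with inl i => a - j <= i | inr _ => false end].
have lasta : a.-1 < a by lia.
have [d0 d0F lastd0] := dumbbell_no_isolated b1 (inl (Ordinal lasta)).
have abs : a + b <= size s by lia.
have [||||E0 [pE0 cE0 gE0]] := @span_extend T x0 s us abs s' E' z S d0 _ pE' cE' gE' _ d0F.
- by lia.
- case=> i; rewrite inE /= mem_cat.
    by rewrite -ltnNge => ij; rewrite -(nth_take x0 ij) mem_nth // size_takel // ss; lia.
  by move=> _; rewrite -nth_drop mem_nth ?orbT // size_drop ltn_subRL ss; have := ltn_ord i; lia.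
- by apply/subsetPn; exists (inl (Ordinal lasta)); rewrite // !inE negbK /=; lia.
- by left=> x xR; rewrite mem_cat xR orbT.
exists E0; split=> //; apply: le_trans cE0 _; rewrite lerD2l /strip_cost lerD2r.
have := edges_meeting_del F S; rewrite -[S]setCK (card_del_edges_dumbbell hca hcb).
rewrite setCK.
have -> : #|[set i | inl i \in ~: S]| = a - j.
  rewrite -[RHS](minn_idPr (leq_subr j a)) -card_ord_lt; apply: eq_card => i.
  by rewrite !inE ltnNge.
have -> : #|[set i | inr i \in ~: S]| = b.
  by rewrite -[RHS]card_ord -cardsT; apply: eq_card => i; rewrite !inE.
set M := [set k | _]; have -> : #|M| = minn c (a - j).
  by rewrite -card_ord_lt; apply: eq_card => k; rewrite !inE andbT ltnNge.
lia.
Qed.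

End Filling.

(** * Costs of the extensions *)

(** Perform one extension for each part of an optimal list. *)
Lemma spannable_gstar (U : finType) (F : sgraph U) (T : finType) (r i : nat) (z : int) :
    r < #|U| ->
    (forall m j y, #|U| <= m -> 0 < j <= #|U| - r ->
       spannable F T m y -> spannable F T (m + j) (y + e_ F j)) ->
    spannable F T #|U| z ->
  spannable F T (#|U| + i) (z + gstar F r i).
Proof.
move=> rU step base; have [w [adw <- ->]] := gstar_attained F i rU.
elim: w adw => [_|j w IH /= /andP[jU /IH span]].
  by rewrite addn0 big_nil addr0.
rewrite big_cons addnCA (addnC j) [(e_ F j + _)%R]addrC addrA.
by apply: step => //; apply: leq_addr.
Qed.

Lemma bin2_double (n : nat) : 2 * 'C(n, 2) + n = n * n.
Proof. by elim: n => // n IH; rewrite binS bin1; nia. Qed.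

Section DumbbellCosts.
Variables (a b c : nat).
Hypotheses (hc : 0 < c) (hca : c <= a) (hab : a <= b) (b1 : 1 < b).

Let hcb : c <= b. Proof. exact: leq_trans hab. Qed.
Let U : finType := ('I_a + 'I_b)%type.
Let F : sgraph U := dumbbell a b c.

(** If [p] left and [q] right vertices remain, at most [minn c (minn p q)] links do. *)
Lemma e_dumbbell_ge (i m : nat) :
    (forall p q, p <= a -> q <= b -> p + q = a + b - i ->
       'C(p, 2) + 'C(q, 2) + minn c (minn p q) <= m) ->
  ((#|edges F|)%:Z - m%:Z - 1 <= e_ F i)%R.
Proof.
(* For [m] above the number of edges the claimed bound is below -1, and [e_ge] with 0 suffices. *)
move=> inside; have [ltlm|lelm] := ltnP #|edges F| m.
  apply: le_trans (e_ge (m := 0) _ _) => //; lia.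
apply: le_trans (e_ge (m := #|edges F| - m) _ _); [lia | exact: leq_subr |].
move=> S Si; have := edges_meeting_del F S; rewrite -[S]setCK (card_del_edges_dumbbell hca hcb).
rewrite setCK; set p := #|[set i | _]|; set q := #|[set j | _]|; set M := #|[set k | _]|.
have pa : p <= a by rewrite -[leqRHS]card_ord max_card.
have qb : q <= b by rewrite -[leqRHS]card_ord max_card.
have Mc : M <= c by rewrite -[leqRHS]card_ord max_card.
have Mp : M <= p.
  have widen_inj : injective (widen_ord hca) by move=> k k' /(congr1 val)/= /val_inj.
  rewrite /M -(card_imset _ widen_inj).
  by apply/subset_leq_card/subsetP => _ /imsetP[k + ->]; rewrite !inE => /andP[].
have Mq : M <= q.
  have widen_inj : injective (widen_ord hcb) by move=> k k' /(congr1 val)/= /val_inj.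
  rewrite /M -(card_imset _ widen_inj).
  by apply/subset_leq_card/subsetP => _ /imsetP[k + ->]; rewrite !inE => /andP[].
have pq : p + q = a + b - i.
  rewrite -Si -(card_dumbbell_vertices a b) -[in RHS](setCK S) -cardsCs.
  have inl_i : injective (@inl 'I_a 'I_b) by move=> x y [].
  have inr_i : injective (@inr 'I_a 'I_b) by move=> x y [].
  rewrite /p /q -(card_imset _ inl_i) -(card_imset [set j | _] inr_i) -cardsUI.
  set I := _ :&: _; have -> : I = set0.
    apply/setP => -[] x; rewrite in_setI in_set0; apply/negP.
      by case/andP => _ /imsetP[].
    by case/andP => /imsetP[].
  rewrite cards0 addn0; apply: eq_card => u; rewrite in_setU; apply/orP/idP.
    by case=> /imsetP[x + ->]; rewrite inE.
  by case: u => x xS; [left | right]; apply/imset_f; rewrite inE.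
have := inside p q pa qb pq; lia.
Qed.

(** Convexity: let x = a - i, and let p = x + d and q = x + y remain on the two sides, so b = x + y
    + d. The pairs inside the sides are d y fewer than for the split (x, b), while at most d more
    links survive. *)
Lemma strip_cost_le_e (i : nat) : i <= a -> (strip_cost a b c i <= e_ F i)%R.
Proof.
move=> ia; rewrite /strip_cost; apply: e_dumbbell_ge => p q pa qb pq.
have [d pd] : exists d, p = a - i + d by exists (p - (a - i)); lia.
have qd : q + d = b by lia.
(* Here y = 0, which forces a = b and the mirror image of the same split. *)
have [qx|xq] := leqP q (a - i).
  have -> : q = a - i by lia.
  have -> : p = b by lia.
  by rewrite ['C(b, 2) + _]addnC leq_add2l; lia.
have [y qy] : exists y, q = (a - i) + y by exists (q - (a - i)); lia.
have dy : d <= d * y by rewrite leq_pmulr //; lia.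
have := bin2_double p; have := bin2_double q; have := bin2_double (a - i).
have := bin2_double b; rewrite -qd pd qy.
move: (a - i) dy => x dy; lia.
Qed.

Lemma bin2_add (m n : nat) : 'C(m + n, 2) = 'C(m, 2) + 'C(n, 2) + m * n.
Proof. by have := bin2_double (m + n); have := bin2_double m; have := bin2_double n; nia. Qed.

(** The [b - t] remaining vertices span at most ['C(b - t, 2)] edges, since the p q cross pairs
    outnumber the links. The left side is the cost of the whole [a]-side plus what is left for [t]
    further vertices. *)
Lemma e_large_ge (t : nat) :
  ((strip_cost a b c a) + ('C(b, 2))%:Z - ('C(b - t, 2))%:Z <= e_ F (a + t))%R.
Proof.
apply: le_trans (e_dumbbell_ge (i := a + t) (m := 'C(b - t, 2)) _).
  by rewrite /strip_cost subnn minn0 bin0n -/F /=; move: #|edges F| => l; lia.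
move=> p q _ _ pq; have -> : b - t = p + q by lia.
rewrite bin2_add leq_add2l; case: p q {pq} => [|p] [|q]; rewrite ?minn0 ?min0n ?minn0 //.
nia.
Qed.

Lemma spannable_strips (T : finType) (m k j : nat) (z : int) :
    0 < j <= a -> a + b <= m ->
  spannable F T m z -> spannable F T (m + k * j) (z + (strip_cost a b c j) *+ k).
Proof.
move=> ja abm span; elim: k => [|k IH]; first by rewrite mul0n addn0 mulr0n addr0.
rewrite mulSnr addnA mulrSr addrA; apply: spannable_strip => //.
by rewrite (leq_trans abm) ?leq_addr.
Qed.

(** For i > a write i = a + k a + p with p < a, and attach k + 1 groups of size a, then one of size
    p. *)
Lemma spannable_step_asym (T : finType) (m i : nat) (z : int) :
    a < b -> a + b <= m -> 0 < i <= a + b - 1 ->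
  spannable F T m z -> spannable F T (m + i) (z + e_ F i).
Proof.
move=> ltab abm /andP[i0 iab] span; have [ia|ai] := leqP i a.
  apply: spannable_mono (spannable_strip hc hca hcb b1 _ abm span); last by rewrite i0.
  by rewrite lerD2l strip_cost_le_e.
have a0 : 0 < a <= a by lia.
pose t := i - a; pose k := t %/ a; pose p := t %% a.
have tE : t = k * a + p := divn_eq t a.
have pa : p < a by rewrite ltn_mod; lia.
have tb : t < b by rewrite /t; lia.
have span_k : spannable F T (m + k.+1 * a) (z + strip_cost a b c a *+ k.+1).
  exact: spannable_strips.
have iE : m + i = m + k.+1 * a + p by rewrite mulSnr; lia.
have eE := e_large_ge t; rewrite {2}/t subnKC ?(ltnW ai) // in eE.
(* By [bin2_add] the right side is C(k a, 2) + (b - t) k a, where b - t >= 1. The first term pays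
   for the k cliques, the second for their links. *)
have main : (strip_cost a b c a *+ k <= ('C(b - p, 2))%:Z - ('C(b - t, 2))%:Z)%R.
  have -> : strip_cost a b c a = Posz ('C(a, 2) + c - 1).
    by rewrite /strip_cost (card_edges_dumbbell hca hcb) subnn minn0 bin0n /=; lia.
  rewrite -mulr_natl natz -PoszM.
  have -> : b - p = (b - t) + k * a by lia.
  have [-> | k0] := posnP k; first by rewrite !mul0n addn0 subrr.
  rewrite bin2_add; have := bin2_double (k * a); have := bin2_double a.
  have aka : a * (k * a) <= (k * a) * (k * a) by rewrite leq_mul2r leq_pmull ?orbT.
  have bta : k * a <= (b - t) * (k * a) by rewrite leq_pmull // subn_gt0.
  have kca : k * c <= k * a by rewrite leq_mul2l hca orbT.
  have kC : 2 * (k * 'C(a, 2)) + k * a = a * (k * a).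
    by rewrite mulnCA -mulnDr bin2_double mulnCA.
  have : k * ('C(a, 2) + c - 1) <= k * 'C(a, 2) + k * c.
    by rewrite -mulnDr leq_mul2l leq_subr orbT.
  move: (k * ('C(a, 2) + c - 1)) (k * 'C(a, 2)) (k * c) ((b - t) * (k * a)) (a * (k * a)) aka bta kca kC.
  by move: (k * a) => *; lia.
(* Here [a < b] enters: at most p links are lost, and (a - p) p + p <= (b - p) p. *)
have first : (strip_cost a b c p <= ('C(b, 2))%:Z - ('C(b - p, 2))%:Z)%R.
  rewrite /strip_cost (card_edges_dumbbell hca hcb).
  have -> : 'C(a, 2) = 'C(a - p, 2) + 'C(p, 2) + (a - p) * p.
    by rewrite -bin2_add subnK // ltnW.
  have -> : 'C(b, 2) = 'C(b - p, 2) + 'C(p, 2) + (b - p) * p.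
    by rewrite -bin2_add subnK //; lia.
  have : (a - p) * p + p <= (b - p) * p by rewrite -mulSnr leq_mul2r; lia.
  by move: ((a - p) * p) ((b - p) * p) => x y; lia.
have [p0|p0] := posnP p.
  rewrite iE p0 addn0; apply: spannable_mono span_k.
  rewrite lerD2l mulrS; move: main eE; rewrite p0 subn0; lia.
rewrite iE; apply: spannable_mono (spannable_strip hc hca hcb b1 _ _ span_k); last 2 first.
- by rewrite p0 ltnW.
- by rewrite (leq_trans abm) ?leq_addr.
rewrite -addrA lerD2l mulrS; move: main first eE; lia.
Qed.

End DumbbellCosts.

(** For i = 5 + t, attach one group of 5 and then t single vertices at cost 3 each: 3, 6, 9 stay
    within the available 4, 7, 9. For t = 4 the cost 12 would exceed 10, but i = 9 is excluded by r
    = 2. *)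
Lemma spannable_step_554 (T : finType) (m i : nat) (z : int) :
    10 <= m -> 0 < i <= 8 ->
  spannable (dumbbell 5 5 4) T m z ->
  spannable (dumbbell 5 5 4) T (m + i) (z + e_ (dumbbell 5 5 4) i).
Proof.
have hc : 0 < 4 by []; have hca : 4 <= 5 by []; have hab : 5 <= 5 by []; have b1 : 1 < 5 by [].
move=> m10 /andP[i0 i8] span; have [i5|i5] := leqP i 5.
  apply: spannable_mono (spannable_strip hc hca hca b1 _ m10 span); last by rewrite i0.
  by rewrite lerD2l strip_cost_le_e.
have span5 : spannable (dumbbell 5 5 4) T (m + 5) (z + strip_cost 5 5 4 5).
  exact: spannable_strip.
have span1 := @spannable_strips _ _ _ hc hca hab b1 T (m + 5) (i - 5) 1 _ isT _ span5.
have -> : m + i = m + 5 + (i - 5) * 1 by lia.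
apply: spannable_mono (span1 _); last by lia.
have cost1 : (strip_cost 5 5 4 1 *+ (i - 5) <= 'C(5, 2)%:Z - 'C(5 - (i - 5), 2)%:Z)%R.
  rewrite /strip_cost (card_edges_dumbbell hca hca).
  by have : i - 5 \in [:: 1; 2; 3] by [rewrite !inE; lia]; rewrite !inE => /or3P[] /eqP ->.
have := e_large_ge hc hca hab b1 (i - 5); rewrite subnKC ?(ltnW i5) //; lia.
Qed.

Theorem theorem5p8 (a b c : nat) (hc : 1 <= c) (hca : c <= a) (hab : a <= b) :
  let F := dumbbell a b c in
  let v := a + b in
  let l := 'C(a, 2) + 'C(b, 2) + c in
  (a < b ->
     forall n : nat, v <= n ->
       ((wsat F n)%:Z = gstar F 1 (n - v) + l%:Z - 1)%R) /\
  (a = 5 -> b = 5 -> c = 4 ->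
     forall n : nat, v <= n ->
       ((wsat F n)%:Z = gstar F 2 (n - v) + l%:Z - 1)%R).
Proof.
move=> F v l; have hcb := leq_trans hca hab.
have vE : #|{: 'I_a + 'I_b}| = v by rewrite card_dumbbell_vertices.
have lE : #|edges F| = l by rewrite (card_edges_dumbbell hca hcb).
(* The two claims differ only in r and in the extension step; both have [c < b], which gives the
   spare vertex of the base clique. *)
suff main r : 0 < r <= 2 -> c < b -> r < v -> 2 < v ->
    (forall T m i z, v <= m -> 0 < i <= v - r ->
       spannable F T m z -> spannable F T (m + i) (z + e_ F i)) ->
    forall n, v <= n -> ((wsat F n)%:Z = gstar F r (n - v) + l%:Z - 1)%R.
  split=> [ltab|a5 b5 c4]; apply: main; rewrite /v //; try lia.
    by move=> T m i z vm iv; apply: spannable_step_asym; lia.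
  move=> T m i z; rewrite /F a5 b5 c4; exact: spannable_step_554.
move=> /andP[r0 r2] cb rv v2 step n vn; apply/le_anti/andP; split.
  apply: wsat_le; rewrite -[X in spannable _ _ X _](subnKC vn).
  have := @spannable_gstar _ F 'I_n r (n - v) (l%:Z - 1); rewrite vE => span.
  apply: spannable_mono (span rv _ _); [lia | by move=> m i z; apply: step |].
  by rewrite -lE; apply: spannable_base.
rewrite -lE -{1}vE; apply: wsat_ge; rewrite ?vE //.
by apply: dumbbell_no_isolated => //; lia.
Qed.
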